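(* Let $p$ be a Wolstenholme prime. Then $$\binom{2p-1}{p-1} \equiv 1 - 2p\sum_{k=1}^{p-1}\frac{1}{k} - 2p^2\sum_{k=1}^{p-1}\frac{1}{k^2} \equiv 1 + 2p\sum_{k=1}^{p-1}\frac{1}{k} + \frac{2p^3}{3}\sum_{k=1}^{p-1}\frac{1}{k^3} \pmod{p^7}.$$
   Context: A prime $p$ is called a Wolstenholme prime if $\binom{2p-1}{p-1}\equiv 1 \pmod{p^4}$. Congruences between rational numbers modulo $p^e$ are understood in the ring of rationals with denominator prime to $p$: $a\equiv b \pmod{p^e}$ means that $a-b$, written in reduced form, has numerator divisible by $p^e$ and denominator prime to $p$. *)

(* Defs.v *)
From mathcomp Require Import all_boot all_order all_algebra.

Set Implicit Arguments.
Unset Strict Implicit.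
Unset Printing Implicit Defensive.

Import Order.TTheory GRing.Theory Num.Theory.

Local Open Scope ring_scope.

Definition wolstenholme_prime (p : nat) : Prop :=
  prime p /\ ('C(2 * p - 1, p - 1) = 1 %[mod p ^ 4])%N.

(* a = b (mod p ^ e) in the ring of rationals with denominator prime to p;
   numq and denq give the reduced fraction. *)
Definition rat_eqmod (p e : nat) (a b : rat) : Prop :=
  ((p ^ e)%N%:Z %| numq (a - b))%Z /\ coprimez (denq (a - b)) p%:Z.

(* Main.v *)
Require Import Defs.
From HB Require Import structures.
From mathcomp Require Import all_boot all_order all_algebra finfield.
From mathcomp Require Import ring.

Set Implicit Arguments.
Unset Strict Implicit.
Unset Printing Implicit Defensive.

Import Order.TTheory GRing.Theory Num.Theory.

Local Open Scope ring_scope.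

(** Let E(X) = prod_(0 < k < p) (1 + X / k) = sum_i e_i X^i, so that the e_i are
the elementary symmetric functions of the 1/k.  Two values of E matter:
E(p) = 'C(2p - 1, p - 1), and E(0) = 1.  The substitution k -> p - k gives the
functional equation E(- X - p) = E(X) for odd p ([harmonic_poly_reflect]), and
reading it coefficientwise gives, for each i,
  e_i = sum_j (-1)^j 'C(j, i) p^(j - i) e_j.
All e_i are p-integral, and p divides e_i for 0 < i < p - 1, because
prod_(0 < k < p) (X + k) = X^(p - 1) - 1 modulo p ([harmonic_poly_modp]).  With
e_6 = 0 mod p, the relation for i = 5 makes e_5 a multiple of p^2; the one for
i = 3 then gives e_3 = 2 p e_4 mod p^4, and the one for i = 0 gives
e_1 = p e_2 - p^3 e_4 mod p^6.  Substituted in E(p), this yields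
  'C(2p - 1, p - 1) = 1 + 2 p^2 e_2 + 2 p^4 e_4  mod p^7
for every prime p > 7 ([harmonic_poly_relations]).

The Wolstenholme condition, together with p | e_4, now says that p^2 divides
e_2, whence p^3 divides e_1.  Newton's identities ([power_sums_elementary])
express the sums of 1/k, 1/k^2 and 1/k^3 through e_1, e_2, e_3; the products
e_1^2, e_1 e_2, e_1^3 they contain are so divisible by p that they disappear
modulo p^7, and both right-hand sides reduce to 1 + 2 p^2 e_2 + 2 p^4 e_4. *)

(** * Rationals with denominator prime to p *)

Definition plocal (p : nat) : {pred rat} := fun x => coprimez (denq x) p%:Z.

Lemma plocalE p x : (x \in plocal p) = coprime `|denq x| p.
Proof. by []. Qed.

(** Any fraction with denominator prime to p will do, reduced or not: the reduced
denominator divides every other one. *)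
Lemma plocal_frac (p : nat) (x : rat) (d n : int) :
  coprimez d p -> x * d%:~R = n%:~R -> x \in plocal p.
Proof.
move=> cdp xd; rewrite unfold_in /plocal.
have nd : numq x * d = n * denq x.
  apply: (@intr_inj rat); rewrite !intrM -xd -{2}[x]divq_num_den.
  by field; rewrite intr_eq0 denq_neq0.
have dd : (denq x %| d)%Z.
  have := dvdz_mull n (dvdzz (denq x)); rewrite -nd Gauss_dvdzr //.
  by rewrite coprimezE coprime_sym coprime_num_den.
by move: cdp dd; rewrite !coprimezE dvdzE => cdp /coprime_dvdl; apply.
Qed.

Lemma plocal_subring p : subring_closed (plocal p).
Proof.
have cM x y : x \in plocal p -> y \in plocal p -> coprimez (denq x * denq y) p.
  by move=> hx hy; rewrite coprimezE abszM coprimeMl; apply/andP.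
have dn0 x : (denq x)%:~R != 0 :> rat by rewrite intr_eq0 denq_neq0.
split=> [|x y hx hy|x y hx hy]; first by rewrite plocalE coprime1n.
  apply: (plocal_frac (n := numq x * denq y - numq y * denq x) (cM x y hx hy)).
  rewrite rmorphB /= !intrM -{1}[x]divq_num_den -{1}[y]divq_num_den.
  by field; rewrite !dn0.
apply: (plocal_frac (n := numq x * numq y) (cM x y hx hy)).
rewrite !intrM -{1}[x]divq_num_den -{1}[y]divq_num_den.
by field; rewrite !dn0.
Qed.

HB.instance Definition _ p :=
  GRing.isSubringClosed.Build rat (plocal p) (@plocal_subring p).

Lemma plocal_natV p n : coprime n p -> n%:R^-1 \in plocal p.
Proof.
have [->|n0] := posnP n; first by rewrite invr0 rpred0.
move=> cnp; apply: (@plocal_frac p _ n%:Z 1); first by rewrite coprimezE.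
by rewrite mulVf // pnatr_eq0 -lt0n.
Qed.

(** The congruence as an equation with an explicit p-integral quotient: chains of
congruences become rewriting steps closed by polynomial identities. *)
Definition plocal_eqmod (p e : nat) (a b : rat) : Prop :=
  exists2 c, c \in plocal p & a = b + p%:R ^+ e * c.

Lemma rat_eqmod_plocal p e (a b c : rat) :
  c \in plocal p -> a - b = p%:R ^+ e * c -> rat_eqmod p e a b.
Proof.
move=> hc; rewrite /rat_eqmod => ->.
have c1 : coprime `|numq c| `|denq c| by exact: coprime_num_den.
have c2 : coprime p `|denq c| by rewrite coprime_sym -plocalE.
have c3 : coprime `|(p ^ e)%N%:Z * numq c| `|denq c|.
  by rewrite abszM coprimeMl c1 andbT; apply: coprimeXl.
have -> : p%:R ^+ e * c = ((p ^ e)%N%:Z * numq c)%:~R / (denq c)%:~R.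
  by rewrite intrM -mulrA divq_num_den -[(Posz _)%:~R]/((p ^ e)%:R) natrX.
rewrite coprimeq_num // coprimeq_den // (negbTE (denq_neq0 c)).
rewrite gtr0_sg ?denq_gt0 // mul1r dvdz_mulr // coprimezE coprime_sym.
Qed.

(** * Truncated expansions in powers of p *)

Lemma coef_reflectX (R : comNzRingType) (c : R) (j i : nat) :
  ((- 'X - c%:P) ^+ j)`_i = (-1) ^+ j * c ^+ (j - i) *+ 'C(j, i).
Proof.
rewrite -opprD addrC (exprNn (_ + _)) exprDn.
have -> : (-1) ^+ j = ((-1) ^+ j)%:P :> {poly R} by rewrite rmorphXn rmorphN1.
rewrite coefCM -mulrnAr; congr (_ * _).
transitivity ((\poly_(k < j.+1) (c ^+ (j - k) *+ 'C(j, k)))`_i).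
  rewrite poly_def !coef_sum; apply: eq_bigr => k _.
  by rewrite -rmorphXn /= coefMn coefCM coefZ mulrnAl.
rewrite coef_poly; case: ltnP => // ji.
by rewrite bin_small.
Qed.

Lemma plocal_sum_trunc p (u : nat -> rat) (i m n : nat) :
    (i <= m <= n)%N -> (forall j, u j \in plocal p) ->
  exists2 t, t \in plocal p &
    \sum_(j < n) u j * p%:R ^+ (j - i) =
    \sum_(j < m) u j * p%:R ^+ (j - i) + p%:R ^+ (m - i) * t.
Proof.
move=> /andP[im mn] hu; exists (\sum_(m <= j < n) u j * p%:R ^+ (j - m)).
  by apply: rpred_sum => j _; rewrite rpredM ?rpredX ?rpred_nat.
rewrite -!(big_mkord xpredT (fun j => u j * p%:R ^+ (j - i))).
rewrite (big_cat_nat _ mn) //=; congr (_ + _).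
rewrite mulr_sumr; apply: eq_big_nat => j /andP[mj _].
by rewrite mulrCA -exprD addnC addnBA // subnK.
Qed.

(** The functional equation P(- X - p) = P(X), read on the coefficient of X^i and
cut at j = m.  In the terms with j < i the truncated exponent j - i is harmless,
since 'C(j, i) = 0. *)
Lemma coef_reflect_trunc p (P : {poly rat}) (i m : nat) :
    (i <= m <= size P)%N -> (forall j, P`_j \in plocal p) ->
    P \Po (- 'X - p%:R%:P) = P ->
  exists2 t, t \in plocal p &
    P`_i = \sum_(j < m) (P`_j * (-1) ^+ j *+ 'C(j, i)) * p%:R ^+ (j - i)
           + p%:R ^+ (m - i) * t.
Proof.
move=> im hP symP.
have [|t ht Et] := @plocal_sum_trunc p (fun j => P`_j * (-1) ^+ j *+ 'C(j, i)) i m (size P) im _.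
  by move=> j; rewrite rpredMn ?rpredM ?rpredX ?rpredN ?rpred1.
exists t; rewrite // -Et -{1}symP coef_comp_poly.
apply: eq_bigr => j _; rewrite coef_reflectX.
by rewrite mulrnAr mulrnAl mulrA.
Qed.

Lemma horner_trunc p (P : {poly rat}) (m : nat) :
    (m <= size P)%N -> (forall j, P`_j \in plocal p) ->
  exists2 t, t \in plocal p &
    P.[p%:R] = \sum_(j < m) P`_j * p%:R ^+ j + p%:R ^+ m * t.
Proof.
move=> mP hP.
have [|t ht Et] := @plocal_sum_trunc p (fun j => P`_j) 0 m (size P) _ hP.
  by rewrite mP.
exists t => //; rewrite horner_coef; move: Et; rewrite subn0.
under eq_bigr do rewrite subn0.
by move->; under eq_bigr do rewrite subn0.
Qed.

(** * The polynomial (X + 1) ... (X + p - 1) *)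

Definition rising_poly (R : nzRingType) (p : nat) : {poly R} :=
  \prod_(1 <= k < p) ('X + k%:R%:P).

Lemma map_rising_poly (R S : nzRingType) (f : {rmorphism R -> S}) p :
  map_poly f (rising_poly R p) = rising_poly S p.
Proof.
rewrite rmorph_prod; apply: eq_bigr => k _ /=.
by rewrite rmorphD /= map_polyX map_polyC /= rmorph_nat.
Qed.

(** Lagrange: both sides are monic of degree p - 1, and by Fermat's little theorem
the p - 1 distinct nonzero elements of the prime field are roots of the
right-hand side. *)
Lemma rising_polyFp p : prime p -> rising_poly 'F_p p = 'X^(p.-1) - 1.
Proof.
move=> pr_p; have p_gt0 := prime_gt0 pr_p; have p_gt1 := prime_gt1 pr_p.
have p1_gt0 : (0 < p.-1)%N by rewrite -subn1 subn_gt0.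
pose rs : seq 'F_p := [seq - k%:R | k <- index_iota 1 p].
have -> : rising_poly 'F_p p = \prod_(z <- rs) ('X - z%:P).
  by rewrite big_map; apply: eq_bigr => k _; rewrite rmorphN opprK.
have szP : size ('X^(p.-1) - 1 : {poly 'F_p}) = (size rs).+1.
  by rewrite -[1]/(1%:P) size_XnsubC // size_map size_iota subn1.
rewrite [RHS](all_roots_prod_XsubC szP).
- have /monicP-> : 'X^(p.-1) - 1 \is @monic 'F_p by rewrite -[1]/(1%:P) monicXnsubC.
  by rewrite scale1r.
- apply/allP => _ /mapP[k + ->]; rewrite mem_index_iota => /andP[k0 kp].
  have k_neq0 : - k%:R != 0 :> 'F_p.
    by rewrite oppr_eq0 -(dvdn_pcharf (pchar_Fp pr_p)) gtnNdvd.
  rewrite rootE !hornerE subr_eq0; apply/eqP/(mulIf k_neq0).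
  by rewrite -exprSr prednK // mul1r; have := expf_card (- k%:R : 'F_p); rewrite card_Fp.
rewrite uniq_rootsE map_inj_in_uniq ?iota_uniq // => i j.
rewrite !mem_index_iota => /andP[_ ip] /andP[_ jp] /oppr_inj/(congr1 (@nat_of_ord _)).
by rewrite !val_Fp_nat // !modn_small.
Qed.

Lemma dvdz_coef_rising_poly p i :
  prime p -> (0 < i < p.-1)%N -> (p %| (rising_poly int p)`_i)%Z.
Proof.
move=> pr_p /andP[i0 ip]; rewrite (dvdz_pcharf (pchar_Fp pr_p)).
rewrite -(coef_map (intmul 1)) /= map_rising_poly rising_polyFp //.
by rewrite coefB coefXn coef1 ltn_eqF // gtn_eqF // subr0.
Qed.

(** X + k becomes - (X + (p - k)), and the p - 1 signs cancel as p - 1 is even. *)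
Lemma rising_poly_reflect p : odd p ->
  rising_poly rat p \Po (- 'X - p%:R%:P) = rising_poly rat p.
Proof.
move=> odd_p; rewrite {2}/rising_poly big_nat_rev /= rmorph_prod /=.
transitivity (\prod_(1 <= k < p) ((-1) * ('X + (1 + p - k.+1)%:R%:P) : {poly rat})).
  apply: eq_big_nat => k /andP[_ kp]; rewrite rmorphD /= comp_polyX comp_polyC.
  rewrite add1n subSS natrB ?(ltnW kp) // rmorphB /=; ring.
rewrite big_split /= prodr_const_nat subn1 -signr_odd.
by case: p odd_p => // p /= /negbTE->; rewrite mul1r.
Qed.

(** The value is (p + 1) ... (2p - 1) = (2p - 1)! / p!. *)
Lemma horner_rising_poly p : (0 < p)%N ->
  (rising_poly rat p).[p%:R] = 'C(2 * p - 1, p - 1)%:R * (p.-1)`!%:R.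
Proof.
move=> p0; rewrite horner_prod.
apply: (mulIf (x := p`!%:R)); first by rewrite pnatr_eq0 -lt0n fact_gt0.
have -> : \prod_(1 <= k < p) ('X + k%:R%:P).[p%:R] = (\prod_(p.+1 <= k < 2 * p) k)%:R :> rat.
  rewrite mul2n -addnn -[p.+1]add1n big_addn addnK natr_prod.
  by apply: eq_bigr => k _; rewrite !hornerE natrD addrC.
rewrite -!natrM; apply: (congr1 (fun n => n%:R)); rewrite [LHS]mulnC.
have E : (2 * p = (2 * p - 1).+1)%N by rewrite subn1 prednK // muln_gt0.
have E' : (2 * p - 1 = p + (p - 1))%N by rewrite mul2n -addnn addnBA.
rewrite {1}E -fact_split ?E' ?leq_addr //.
rewrite -(@bin_fact (p + (p - 1)) (p - 1)) ?leq_addl // addnK.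
by rewrite subn1 mulnA.
Qed.

(** * Elementary symmetric functions of the inverses 1/k *)

(** Newton's identities in degrees 1, 2 and 3.  The induction on r only uses that
a factor 1 + a X changes e_i into e_i + a e_(i - 1). *)
Lemma power_sums_elementary (r : seq nat) (a : nat -> rat) :
  let e i := (\prod_(k <- r) (1 + (a k)%:P * 'X))`_i in
  let h n := \sum_(k <- r) a k ^+ n in
  [/\ e 0%N = 1, h 1%N = e 1%N, h 2%N = e 1%N ^+ 2 - 2 * e 2%N &
      h 3%N = e 1%N ^+ 3 - 3 * e 1%N * e 2%N + 3 * e 3%N].
Proof.
elim: r => [|k r [e0 h1 h2 h3]] /=.
  by rewrite !big_nil !coef1 /=; split=> //; ring.
rewrite !big_cons h1 h2 h3 !mulrDl !mul1r !coefD -!mulrA !coefCM !coefXM /= e0.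
by split; ring.
Qed.

Definition harmonic_poly (p : nat) : {poly rat} :=
  \prod_(1 <= k < p) (1 + (k%:R^-1)%:P * 'X).

Lemma rising_harmonic p : (0 < p)%N ->
  rising_poly rat p = (p.-1)`!%:R *: harmonic_poly p.
Proof.
move=> p0; rewrite fact_prod prednK // natr_prod -mul_polyC rmorph_prod -big_split /=.
apply: eq_big_nat => k /andP[k0 _].
rewrite mulrDr mulr1 mulrA -polyCM divff ?pnatr_eq0 -?lt0n // mul1r.
by rewrite addrC.
Qed.

Lemma fact_rat_neq0 n : n`!%:R != 0 :> rat.
Proof. by rewrite pnatr_eq0 -lt0n fact_gt0. Qed.

Lemma size_harmonic_poly p : (0 < p)%N -> size (harmonic_poly p) = p.
Proof.
move=> p0; have D0 := fact_rat_neq0 p.-1.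
rewrite -(size_scale _ D0) -rising_harmonic // /rising_poly.
under eq_bigr do rewrite -[_%:R%:P]opprK -rmorphN.
by rewrite size_prod_XsubC size_iota subn1 prednK.
Qed.

Lemma coprime_pred_fact p : prime p -> coprime (p.-1)`! p.
Proof.
move=> pr_p; rewrite coprime_sym prime_coprime // fact_prod.
rewrite prednK ?prime_gt0 // Euclid_dvd_prod //.
rewrite big_nat big1 // => k /andP[k0 kp]; exact: gtnNdvd.
Qed.

Lemma coef_harmonic_poly p i : (0 < p)%N ->
  (harmonic_poly p)`_i = ((rising_poly int p)`_i)%:~R * (p.-1)`!%:R^-1.
Proof.
move=> p0; have D0 := fact_rat_neq0 p.-1.
apply: (mulIf D0); rewrite mulfVK // mulrC -coefZ -rising_harmonic //.
by rewrite -(map_rising_poly (intmul 1 : {rmorphism int -> rat})) coef_map.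
Qed.

Lemma plocal_harmonic_poly p i : prime p -> (harmonic_poly p)`_i \in plocal p.
Proof.
move=> pr_p; rewrite coef_harmonic_poly ?prime_gt0 //.
by rewrite rpredM ?rpred_int // plocal_natV // coprime_pred_fact.
Qed.

(** The e_i are, up to the p-adic unit (p - 1)!, the coefficients of
(X + 1) ... (X + p - 1), which vanish modulo p in this range. *)
Lemma harmonic_poly_modp p i : prime p -> (0 < i < p.-1)%N ->
  plocal_eqmod p 1 (harmonic_poly p)`_i 0.
Proof.
move=> pr_p hi; have /dvdzP[q Eq] := dvdz_coef_rising_poly pr_p hi.
exists (q%:~R * (p.-1)`!%:R^-1).
  by rewrite rpredM ?rpred_int // plocal_natV // coprime_pred_fact.
by rewrite coef_harmonic_poly ?prime_gt0 // Eq intrM add0r mulrAC mulrC.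
Qed.

Lemma harmonic_poly_reflect p : odd p ->
  harmonic_poly p \Po (- 'X - p%:R%:P) = harmonic_poly p.
Proof.
move=> odd_p; have D0 := fact_rat_neq0 p.-1.
apply: (scalerI D0); rewrite -comp_polyZ -rising_harmonic ?odd_gt0 //.
exact: rising_poly_reflect.
Qed.

Lemma horner_harmonic_poly p : (0 < p)%N ->
  (harmonic_poly p).[p%:R] = 'C(2 * p - 1, p - 1)%:R.
Proof.
move=> p0; have D0 := fact_rat_neq0 p.-1.
apply: (mulIf D0); rewrite -horner_rising_poly // rising_harmonic // hornerZ.
exact: mulrC.
Qed.

(** * The expansion modulo p^7 *)

(** The reflection relations for i = 0, 3, 5 with their seven terms written out.
For odd i the term j = i of the sum is - e_i, hence the factors 2 on the left. *)
Lemma low_coef_relations (e : nat -> rat) (x t0 t3 t5 : rat) :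
  let s i := \sum_(j < 7) e j * (-1) ^+ j *+ 'C(j, i) * x ^+ (j - i) in
    e 0%N = s 0%N + x ^+ 7 * t0 -> e 3%N = s 3%N + x ^+ 4 * t3 ->
    e 5%N = s 5%N + x ^+ 2 * t5 ->
  [/\ x * e 1%N = x ^+ 2 * e 2%N - x ^+ 3 * e 3%N + x ^+ 4 * e 4%N
                  - x ^+ 5 * e 5%N + x ^+ 6 * e 6%N + x ^+ 7 * t0,
      2 * e 3%N = 4 * x * e 4%N - 10 * x ^+ 2 * e 5%N + 20 * x ^+ 3 * e 6%N
                  + x ^+ 4 * t3 &
      2 * e 5%N = 6 * x * e 6%N + x ^+ 2 * t5].
Proof.
move=> s E0 E3 E5.
(* The binomials that survive: those with j > i for i = 3 and i = 5. *)
have B : [/\ 'C(4, 3) = 4, 'C(5, 3) = 10, 'C(6, 3) = 20 & 'C(6, 5) = 6]%N by [].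
split.
- rewrite -[LHS]addr0 -(subrr (e 0%N)) {1}E0 /s !big_ord_recr big_ord0 /=.
  by rewrite !bin0 /subn /=; ring.
- rewrite -[2]/(1 + 1) mulrDl mul1r {1}E3 /s !big_ord_recr big_ord0 /=.
  case: B => -> -> -> _; rewrite !binn !bin_small // !mulr0n /subn /=.
  by ring.
rewrite -[2]/(1 + 1) mulrDl mul1r {1}E5 /s !big_ord_recr big_ord0 /=.
case: B => _ _ _ ->; rewrite !binn !bin_small // !mulr0n /subn /=.
by ring.
Qed.

(** Each relation improves the next one: e_6 = 0 mod p gives e_5 = 0 mod p^2,
which gives e_3 mod p^4, which gives e_1 mod p^6.  After these substitutions
only e_2 and e_4 are left in E(p) modulo p^7.  The bound p > 7 is what makes
e_6 divisible by p. *)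
Lemma harmonic_poly_relations p : prime p -> (7 < p)%N ->
  let e i := (harmonic_poly p)`_i in let x : rat := p%:R in
  [/\ plocal_eqmod p 6 (e 1%N) (x * e 2%N - x ^+ 3 * e 4%N),
      plocal_eqmod p 4 (e 3%N) (2 * x * e 4%N) &
      plocal_eqmod p 7 'C(2 * p - 1, p - 1)%:R
        (1 + 2 * x ^+ 2 * e 2%N + 2 * x ^+ 4 * e 4%N)].
Proof.
move=> pr_p p7 e x; have p0 := prime_gt0 pr_p.
have odd_p : odd p by case/even_prime: pr_p p7 => [->|].
have x0 : x != 0 by rewrite pnatr_eq0 -lt0n.
have hx : x \in plocal p by rewrite rpred_nat.
have hV2 : (2%:R)^-1 \in plocal p by rewrite plocal_natV // coprime2n.
have e0 : e 0%N = 1.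
  by have [] := power_sums_elementary (index_iota 1 p) (fun k => k%:R^-1).
have he i : e i \in plocal p by apply: plocal_harmonic_poly.
have p_size : (7 <= size (harmonic_poly p))%N by rewrite size_harmonic_poly // ltnW.
have refl i (i7 : (i <= 7)%N) :=
  @coef_reflect_trunc p _ i 7 (introT andP (conj i7 p_size)) he
    (harmonic_poly_reflect odd_p).
have [t0 ht0 E0] := refl 0%N isT; have [t3 ht3 E3] := refl 3%N isT.
have [t5 ht5 E5] := refl 5%N isT.
have [t ht EC] := horner_trunc p_size he; rewrite horner_harmonic_poly // in EC.
have [{}E0 {}E3 {}E5] := @low_coef_relations e x t0 t3 t5 E0 E3 E5.
have {}EC : 'C(2 * p - 1, p - 1)%:R = 1 + x * e 1%N + x ^+ 2 * e 2%N
    + x ^+ 3 * e 3%N + x ^+ 4 * e 4%N + x ^+ 5 * e 5%N + x ^+ 6 * e 6%N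
    + x ^+ 7 * t.
  rewrite EC; under eq_bigr => j _ do rewrite -/(e j) -/x.
  by rewrite !big_ord_recr big_ord0 /= e0 -/x; ring.
have [|c6 hc6 E6] := @harmonic_poly_modp p 6 pr_p; first by rewrite /= ltn_predRL.
rewrite -/(e 6%N) -/x add0r in E6; move: he => _.
move: (e 1%N) (e 2%N) (e 3%N) (e 4%N) (e 5%N) (e 6%N) E0 E3 E5 E6 EC
  => e1 e2 e3 e4 e5 e6 E0 E3 E5 E6 EC.
have two0 : 2 != 0 :> rat by [].
have [c5 hc5 {}E5] : exists2 c5, c5 \in plocal p & e5 = x ^+ 2 * c5.
  exists ((6 * c6 + t5) / 2); first by rewrite rpredM // rpredD // rpredM ?rpred_nat.
  by apply: (mulfI two0); rewrite E5 E6; field.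
have [a3 ha3 {}E3] : exists2 a3, a3 \in plocal p & e3 = 2 * x * e4 + x ^+ 4 * a3.
  exists ((20 * c6 - 10 * c5 + t3) / 2).
    by rewrite rpredM // rpredD // rpredB // rpredM ?rpred_nat.
  by apply: (mulfI two0); rewrite E3 E5 E6; field.
have [a1 ha1 {}E1] : exists2 a1, a1 \in plocal p &
    e1 = x * e2 - x ^+ 3 * e4 + x ^+ 6 * a1.
  exists (c6 - a3 - c5 + t0); first by rewrite rpredD // rpredB // rpredB.
  by apply: (mulfI x0); rewrite E0 E3 E5 E6; ring.
split; [by exists a1 | by exists a3 | exists (a1 + a3 + c5 + c6 + t)].
  by rewrite !rpredD.
by rewrite EC E1 E3 E5 E6 -/x; ring.
Qed.

(** * Wolstenholme primes *)

(** The primes 2, 3, 5, 7 fail the defining congruence by computation. *)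
Lemma wolstenholme_prime_gt7 p : wolstenholme_prime p -> (7 < p)%N.
Proof.
case=> pr_p C1; rewrite ltnNge; apply/negP => p_le7.
by move: pr_p C1; do 8! [case: p p_le7 => [|p] p_le7 //].
Qed.

Lemma wolstenholme_prime_bin p : wolstenholme_prime p ->
  plocal_eqmod p 4 'C(2 * p - 1, p - 1)%:R 1.
Proof.
case=> _ /eqP; rewrite eqn_mod_dvd; last first.
  by rewrite bin_gt0 leq_sub2r // leq_pmull.
case/dvdnP=> m Em; exists m%:R; rewrite ?rpred_nat //.
rewrite -natrX -natrM (mulnC (p ^ 4)%N) -Em -(natrD _ 1).
by rewrite subnKC // bin_gt0 leq_sub2r // leq_pmull.
Qed.

Theorem corollary1 (p : nat) (hp : wolstenholme_prime p) :
  rat_eqmod p 7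
    ('C(2 * p - 1, p - 1)%N%:R)
    (1 - 2 * p%:R * (\sum_(1 <= k < p) 1 / k%:R)
       - 2 * p%:R ^+ 2 * (\sum_(1 <= k < p) 1 / k%:R ^+ 2))
  /\
  rat_eqmod p 7
    (1 - 2 * p%:R * (\sum_(1 <= k < p) 1 / k%:R)
       - 2 * p%:R ^+ 2 * (\sum_(1 <= k < p) 1 / k%:R ^+ 2))
    (1 + 2 * p%:R * (\sum_(1 <= k < p) 1 / k%:R)
       + 2 * p%:R ^+ 3 / 3 * (\sum_(1 <= k < p) 1 / k%:R ^+ 3)).
Proof.
have [pr_p _] := hp; have p7 := wolstenholme_prime_gt7 hp; have p0 := prime_gt0 pr_p.
set C := 'C(_, _)%:R; set h1 := \sum_(_ <= _ < _) _; set h2 := \sum_(_ <= _ < _) _.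
set h3 := \sum_(_ <= _ < _) _; set x : rat := p%:R.
pose e i := (harmonic_poly p)`_i.
have [[a1 ha1 E1] [a3 ha3 E3] [aC haC EC]] := harmonic_poly_relations pr_p p7.
have [m hm Em] := wolstenholme_prime_bin hp.
have [|c4 hc4 E4] := @harmonic_poly_modp p 4 pr_p.
  by rewrite /= ltn_predRL (leq_trans _ p7).
have [_] := power_sums_elementary (index_iota 1 p) (fun k => k%:R^-1).
rewrite -/(harmonic_poly p).
have h_E n : \sum_(1 <= k < p) 1 / k%:R ^+ n = \sum_(1 <= k < p) k%:R^-1 ^+ n :> rat.
  by apply: eq_bigr => k _; rewrite div1r exprVn.
rewrite -!h_E -/h1 -/h2 -/h3 => H1 H2 H3.
rewrite -/C -/x -/(e 1%N) -/(e 2%N) -/(e 3%N) -/(e 4%N) add0r in E1 E3 EC Em E4 H1 H2 H3.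
move: (e 1%N) (e 2%N) (e 3%N) (e 4%N) E1 E3 EC E4 H1 H2 H3 => e1 e2 e3 e4 E1 E3 EC E4 H1 H2 H3.
have x0 : x != 0 by rewrite pnatr_eq0 -lt0n.
have hx : x \in plocal p by rewrite rpred_nat.
have hV n : (0 < n < 4)%N -> n%:R^-1 \in plocal p.
  case/andP=> n0 n4; rewrite plocal_natV // coprime_sym prime_coprime //.
  by rewrite gtnNdvd // (ltn_trans n4) // (leq_trans _ p7).
(* Comparing 1 + 2 p^2 e_2 + 2 p^4 e_4 with 1 mod p^4 yields e_2 = p^2 d2, and
   then e_1 = p^3 d1. *)
pose d2 := (m - 2 * x * c4 - x ^+ 3 * aC) / 2.
pose d1 := d2 - x * c4 + x ^+ 3 * a1.
have hd2 : d2 \in plocal p.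
  by rewrite !(rpred_nat, rpredM, rpredB, rpredX, hV).
have hd1 : d1 \in plocal p.
  by rewrite rpredD ?rpredB // rpredM // rpredX.
have E2 : e2 = x ^+ 2 * d2.
  have xx0 : 2 * x ^+ 2 != 0 by rewrite mulf_neq0 ?expf_neq0.
  apply: (mulfI xx0); apply: (addrI 1).
  have -> : 1 + 2 * x ^+ 2 * e2 = C - 2 * x ^+ 4 * e4 - x ^+ 7 * aC by rewrite EC; ring.
  by rewrite Em E4 /d2; field.
have E1' : e1 = x ^+ 3 * d1 by rewrite E1 E2 E4 /d1; ring.
have Ed1 : d1 = d2 - x * c4 + x ^+ 3 * a1 by [].
clearbody d1 d2.
split.
  apply: (@rat_eqmod_plocal _ _ _ _ (aC + 2 * a1 + 2 * x * d1 ^+ 2)).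
    by rewrite !(rpred_nat, rpredD, rpredM, rpredX).
  by rewrite H1 H2 EC -/x; rewrite E1' E2 E4 Ed1; ring.
apply: (@rat_eqmod_plocal _ _ _ _
  (- 4 * a1 - 2 * a3 - 2 * x * d1 ^+ 2 - 2 / 3 * x ^+ 5 * d1 ^+ 3 + 2 * x * d1 * d2)).
  by rewrite !(rpred_nat, rpredD, rpredB, rpredM, rpredN, rpredX, hV).
by rewrite H1 H2 H3 -/x E3 E1' E2 E4 Ed1; field.
Qed.
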